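(* Let $A\in\mathbb R^{n\times n}$ be symmetric positive semidefinite of rank $k$ and let $r\in\{1,\dots,k\}$. Then there exists a subset of indices $J^*\subset\{1,\dots,n\}$ with $|J^*|=r$ such that $A(J^*,J^* )$ is invertible and $$\|A-A_{J^*}\|_*\leq (r+1)\cdot\sum_{s\geq r+1}\sigma_s(A)\qquad\text{and}\qquad \|A-A_{J^*}\|_F\leq \sqrt{n-r}\cdot(r+1)\cdot\sqrt{\sum_{s\geq r+1}\sigma_s(A)^2}.$$
   Context: For index sets $I,J\subset\{1,\dots,n\}$, $A(I,J)$ denotes the submatrix of $A$ with rows indexed by $I$ and columns indexed by $J$; the symbol $:$ stands for the full index set $\{1,\dots,n\}$. For $J$ such that $A(J,J)$ is invertible, the cross approximation of $A$ associated with $J$ is $$A_J:=A(:,J)\,A(J,J)^{-1}\,A(J,:).$$ $\sigma_1(A)\geq\sigma_2(A)\geq\dots\geq\sigma_n(A)$ are the singular values of $A$, and the sums over $s\geq r+1$ run over $s=r+1,\dots,n$. $\|\cdot\|_*$ is the nuclear norm (sum of the singular values) and $\|\cdot\|_F$ the Frobenius norm. *)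

(* Defs.v *)
From mathcomp Require Import all_boot all_order all_algebra.
From mathcomp Require Import polyrcf.
From mathcomp Require Import reals.

Set Implicit Arguments.
Unset Strict Implicit.
Unset Printing Implicit Defensive.

Import Order.TTheory GRing.Theory Num.Theory.
Local Open Scope ring_scope.

Definition psdmx (R : numDomainType) (n : nat) (A : 'M[R]_n) : Prop :=
  A^T = A /\ forall x : 'cV[R]_n, 0 <= (x^T *m A *m x) 0 0.

(* A(I, J), with the rows in I and the columns in J listed in increasing
   order ([enum_val] enumerates a set of ordinals increasingly). *)
Definition submat (R : Type) (m n : nat) (A : 'M[R]_(m, n))
    (I : {set 'I_m}) (J : {set 'I_n}) : 'M[R]_(#|I|, #|J|) :=
  mxsub (fun i : 'I_#|I| => enum_val i) (fun j : 'I_#|J| => enum_val j) A.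

(* A(:, J) and A(J, :) are [colsub] and [rowsub], which keep the full index
   type ['I_n] on the other side.  [invmx] returns its argument on a singular
   matrix, so this is the cross approximation only if A(J, J) is invertible. *)
Definition cross_approx (R : comUnitRingType) (n : nat) (A : 'M[R]_n)
    (J : {set 'I_n}) : 'M[R]_n :=
  colsub (fun j : 'I_#|J| => enum_val j) A *m invmx (submat A J J)
    *m rowsub (fun j : 'I_#|J| => enum_val j) A.

(* Eigenvalues in R, repeated according to algebraic multiplicity: [rootsR]
   lists every root of the characteristic polynomial once. *)
Definition eigenvalues (R : rcfType) (n : nat) (M : 'M[R]_n) : seq R :=
  flatten [seq nseq (mup x (char_poly M)) x | x <- rootsR (char_poly M)].

(* Square roots of the eigenvalues of A^T A, in nonincreasing order. *)
Definition singular_values (R : rcfType) (n : nat) (A : 'M[R]_n) : seq R :=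
  sort >=%R [seq Num.sqrt x | x <- eigenvalues (A^T *m A)].

(* The indexing is 1-based: [sigma A 1] is the largest singular value. *)
Definition sigma (R : rcfType) (n : nat) (A : 'M[R]_n) (s : nat) : R :=
  nth 0 (singular_values A) s.-1.

Definition nuclear_norm (R : rcfType) (n : nat) (A : 'M[R]_n) : R :=
  \sum_(1 <= s < n.+1) sigma A s.

Definition frobenius_norm (R : rcfType) (n : nat) (A : 'M[R]_n) : R :=
  Num.sqrt (\sum_(i < n) \sum_(j < n) A i j ^+ 2).

(* Main.v *)
Require Import Defs.
From mathcomp Require Import all_boot all_order all_algebra.
From mathcomp Require Import complex polyrcf ring reals.

(** Among all r-subsets J, choose one at random with probability proportional
    to det A(J,J) (volume sampling).  Write w J := det A(J,J), which is
    nonnegative because A(J,J) is positive semidefinite, and e_k for the k-th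
    elementary symmetric function of the eigenvalues of A, so that e_k is the
    sum of the principal minors of order k (esym_singular_values).

    If A(J,J) is invertible then the residual A - A_J is a Schur complement, and
    its diagonal entry at i outside J is w(J + i) / w(J) (det_submat_setU1),
    while its rows in J vanish.  Hence w(J) * tr(A - A_J) is the sum of w(J + i)
    over the i outside J.  Summing over J counts each set of r + 1 indices r + 1
    times (sum_setU1), so the mean of tr(A - A_J) is at most
    (r + 1) e_(r+1) / e_r.  List the eigenvalues in decreasing order.  In a
    product of r + 1 of them, the last factor stands at position r + 1 or later,
    so e_(r+1) is at most e_r times the sum of the eigenvalues at positions
    beyond r (esym_succ_le).  Since e_r > 0 when r is at most the rank of A, some
    J of positive weight does at least as well as the mean (weighted_mean).

    The residual is itself positive semidefinite (psdmx_cross_residual).  So its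
    nuclear norm is its trace, and its Frobenius norm is at most its trace; one
    set J thus serves for both inequalities, and the second one follows from the
    first by Cauchy-Schwarz on the n - r smallest singular values.

    The eigenvalues themselves come from the spectral theorem for Hermitian
    matrices over the complex extension of the base field (psd_diagonalizable).
    A change of basis over the base field, not necessarily orthogonal, is all
    that is retained from it: it determines traces, ranks, characteristic
    polynomials and the singular values of a symmetric matrix. *)

Set Implicit Arguments.
Unset Strict Implicit.
Unset Printing Implicit Defensive.

Import Order.TTheory GRing.Theory Num.Theory.
Local Open Scope ring_scope.

(** * Principal submatrices and their minors *)

(** Both sides are the determinant of the block matrix with rows (1, -U) and
    (V, 1), computed by clearing V from the right and from the left. *)
Lemma det_addM_comm (R : comNzRingType) (m n : nat)
    (U : 'M[R]_(m, n)) (V : 'M[R]_(n, m)) :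
  \det (1%:M + U *m V) = \det (1%:M + V *m U).
Proof.
pose K := block_mx 1%:M (- U) V 1%:M.
have E1 : K *m block_mx 1%:M 0 (- V) 1%:M
    = block_mx (1%:M + U *m V) (- U) 0 1%:M.
  rewrite mulmx_block !mulmx1 !mul1mx !mulmx0 mulmxN mulNmx opprK.
  by rewrite !add0r subrr.
have E2 : block_mx 1%:M 0 (- V) 1%:M *m K
    = block_mx 1%:M (- U) 0 (1%:M + V *m U).
  rewrite mulmx_block !mulmx1 !mul1mx !mul0mx mulmxN mulNmx opprK !addr0 addrC.
  by rewrite subrr [V *m U + _]addrC.
transitivity (\det K).
  have := congr1 determinant E1.
  by rewrite det_mulmx det_lblock det_ublock !det1 !mulr1.
have := congr1 determinant E2.
by rewrite det_mulmx det_lblock det_ublock !det1 !mul1r.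
Qed.

(** The determinant of this n x n matrix is the principal minor of A on J
    (det_rows_or_id).  Keeping the size n makes minors over different J
    comparable, and avoids the enumeration of J by ['I_#|J|]. *)
Definition rows_or_id {R : pzRingType} {n : nat} (J : {set 'I_n})
    (A : 'M[R]_n) : 'M[R]_n :=
  \matrix_(i, j) if i \in J then A i j else (i == j)%:R.

Definition sel (R : pzRingType) {n : nat} (J : {set 'I_n}) : 'M[R]_(n, #|J|) :=
  colsub (fun j : 'I_#|J| => enum_val j) 1%:M.

Section Selection.
Context {R : comNzRingType} {n : nat}.
Implicit Types (A : 'M[R]_n) (J : {set 'I_n}).

Lemma rowsub_sel {m} J (B : 'M[R]_(n, m)) :
  rowsub (fun j : 'I_#|J| => enum_val j) B = (sel R J)^T *m B.
Proof. by rewrite [LHS]rowsubE /sel trmx_mxsub trmx1. Qed.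

Lemma colsub_sel {m} J (B : 'M[R]_(m, n)) :
  colsub (fun j : 'I_#|J| => enum_val j) B = B *m sel R J.
Proof. by apply: trmx_inj; rewrite trmx_mxsub rowsub_sel trmx_mul. Qed.

Lemma submat_sel A J : submat A J J = (sel R J)^T *m A *m sel R J.
Proof.
rewrite -colsub_sel -rowsub_sel /submat.
by apply/matrixP => i j; rewrite !mxE.
Qed.

Lemma tr_sel_sel J : (sel R J)^T *m sel R J = 1%:M.
Proof.
rewrite -rowsub_sel; apply/matrixP => i j; rewrite !mxE.
by rewrite (inj_eq enum_val_inj).
Qed.

Lemma sel_tr_mul {m} J (B : 'M[R]_(n, m)) i j :
  (sel R J *m ((sel R J)^T *m B)) i j = if i \in J then B i j else 0.
Proof.
rewrite -rowsub_sel mxE.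
under eq_bigr do rewrite !mxE.
rewrite -(big_enum_val (A := mem J) (fun k => (i == k)%:R * B k j)) /=.
case: ifP => iJ.
  rewrite (bigD1 i) //= eqxx mul1r big1 ?addr0 // => k /andP[_ ki].
  by rewrite eq_sym (negbTE ki) mul0r.
rewrite big1 // => k kJ; case: eqP => [ik|_]; last by rewrite mul0r.
by rewrite ik kJ in iJ.
Qed.

Lemma rows_or_idE A J :
  rows_or_id J A = 1%:M + sel R J *m ((sel R J)^T *m (A - 1%:M)).
Proof.
apply/matrixP => i j; rewrite [in RHS]mxE sel_tr_mul !mxE.
by case: ifP => _; rewrite ?addr0 // addrC subrK.
Qed.

(** [rows_or_id J A] is a perturbation of the identity that factors through the
    coordinates in J; exchanging the two factors of the perturbation leaves
    A(J,J). *)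
Lemma det_rows_or_id A J : \det (rows_or_id J A) = \det (submat A J J).
Proof.
rewrite rows_or_idE det_addM_comm submat_sel mulmxBr mulmxBl mulmx1.
by rewrite tr_sel_sel addrC subrK.
Qed.

(** In the Leibniz formula, each factor is the sum of an entry of 1 and an entry
    of XA; expanding the product selects the set J of rows where the entry of XA
    is taken, and the terms with a given J form the determinant of
    [rows_or_id J A]. *)
Lemma det_1_addX A :
  \det (1%:M + 'X *: map_mx polyC A)
    = \sum_(J : {set 'I_n}) (\det (submat A J J))%:P * 'X^#|J|.
Proof.
under [RHS]eq_bigr do rewrite -det_rows_or_id /determinant raddf_sum mulr_suml.
rewrite exchange_big; apply: eq_bigr => s _ /=.
under eq_bigr do rewrite !mxE addrC.
rewrite (bigA_distr 1 (GRing.add : Monoid.add_law 0 *%R)) mulr_sumr.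
apply: eq_bigr => J _.
rewrite rmorphM rmorph_sign -mulrA; congr (_ * _).
rewrite rmorph_prod -prodr_const [X in _ = _ * X]big_mkcond -big_split /=.
apply: eq_bigr => i _; rewrite !mxE.
by case: ifP => _; rewrite ?mulr1 ?rmorph_nat // mulrC.
Qed.

End Selection.

(** * The residual of a cross approximation *)

Section Residual.
Context {R : fieldType} {n : nat}.
Variables (A : 'M[R]_n) (J : {set 'I_n}).
Hypothesis AJ_unit : submat A J J \in unitmx.

(** When A is symmetric, this is the projection whose kernel is spanned by the
    coordinate vectors in J and whose range is orthogonal to them for the
    bilinear form of A. *)
Definition residual_map : 'M[R]_n :=
  1%:M - sel R J *m invmx (submat A J J) *m ((sel R J)^T *m A).

Lemma residualE : A - cross_approx A J = A *m residual_map.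
Proof.
rewrite /cross_approx rowsub_sel colsub_sel /residual_map mulmxBr mulmx1.
by rewrite !mulmxA.
Qed.

Lemma tr_sel_residual : (sel R J)^T *m (A - cross_approx A J) = 0.
Proof.
rewrite /cross_approx rowsub_sel colsub_sel mulmxBr !mulmxA -submat_sel.
by rewrite mulmxV // mul1mx subrr.
Qed.

Lemma residual_map_id {i} j : i \notin J -> residual_map i j = (i == j)%:R.
Proof.
move=> iJ; rewrite /residual_map !mxE big1 ?subr0 // => k _.
rewrite mxE big1 ?mul0r // => l _; rewrite !mxE.
case: eqP => [ie|_]; last by rewrite mul0r.
by rewrite ie enum_valP in iJ.
Qed.

Lemma residual_row0 {i} j : i \in J -> (A - cross_approx A J) i j = 0.
Proof.
move=> iJ; have := sel_tr_mul J (A - cross_approx A J) i j.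
by rewrite iJ tr_sel_residual mulmx0 mxE => <-.
Qed.

(** The Schur complement formula for a determinant.  Passing from J to J + i
    changes only row i of [rows_or_id J A], which is a rank-one update; column i
    of [residual_map] solves the linear system that the update formula for
    determinants requires. *)
Lemma det_submat_setU1 i : i \notin J ->
  \det (submat A (i |: J) (i |: J))
    = \det (submat A J J) * (A - cross_approx A J) i i.
Proof.
move=> iJ; rewrite -!det_rows_or_id.
set V := residual_map; set M := rows_or_id J A.
have MV : M *m col i V = delta_mx i 0.
  apply/matrixP => k j; rewrite ord1 !mxE eqxx andbT.
  have [kJ|kJ] := boolP (k \in J).
    have -> : (k == i) = false by apply: contraNF iJ => /eqP <-.
    rewrite -[RHS](residual_row0 i kJ) residualE [RHS]mxE.
    by apply: eq_bigr => l _; rewrite !mxE kJ.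
  rewrite (bigD1 k) //= [col i V k 0]mxE (residual_map_id i kJ) mxE.
  rewrite (negbTE kJ) eqxx mul1r.
  rewrite big1 ?addr0 // => l lk.
  by rewrite mxE (negbTE kJ) eq_sym (negbTE lk) mul0r.
have -> : rows_or_id (i |: J) A = M *m (1%:M + col i V *m row i (A - 1%:M)).
  rewrite mulmxDr mulmx1 mulmxA MV; apply/matrixP => k j.
  rewrite !mxE big_ord1 !mxE in_setU1 eqxx andbT.
  case: eqP => [->|_] /=; last by rewrite mul0r addr0.
  by rewrite (negbTE iJ) mul1r addrC subrK.
rewrite det_mulmx; congr (_ * _).
rewrite det_addM_comm det_mx11 residualE -/V.
have wv : (row i (A - 1%:M) *m col i V) 0 0 = (A *m V) i i - 1.
  have <- : ((A - 1%:M) *m V) i i = (A *m V) i i - 1.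
    by rewrite mulmxBl mul1mx mxE [X in _ + X]mxE (residual_map_id i iJ) eqxx.
  by rewrite !mxE; apply: eq_bigr => l _; rewrite !mxE.
by rewrite mxE wv mxE eqxx addrC subrK.
Qed.

End Residual.

(** * Spectra of diagonalizable and of positive semidefinite matrices *)

(** A is Hermitian over the complex extension, hence diagonalizable there with
    real eigenvalues; two real matrices that are similar over the complex
    numbers are similar over the reals.  A row v of the change of basis then
    satisfies v A = d v, and d is nonnegative because d |v|^2 = v A v^T is. *)
Lemma psd_diagonalizable (R : rcfType) (n : nat) (A : 'M[R]_n) : psdmx A ->
  exists (P : 'M[R]_n) (d : 'rV[R]_n),
    [/\ P \in unitmx, P *m A = diag_mx d *m P & forall i, 0 <= d 0 i].
Proof.
move=> [A_sym A_ge0].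
pose f := real_complex R; pose AC := map_mx f A.
have AC_real : AC \is a mxOver Num.real.
  by apply/mxOverP => i j; rewrite mxE complex_real.
have AC_herm : AC \is hermsymmx.
  apply: realsym_hermsym => //; apply/is_hermitianmxP.
  by rewrite expr0 scale1r map_mx_id // /AC map_trmx A_sym.
have /orthomx_spectralP AC_diag := hermitian_normalmx AC_herm.
have D_real := hermitian_spectral_diag_real AC_herm.
set Q := spectralmx AC in AC_diag; set D := spectral_diag AC in AC_diag D_real.
have Q_unit : Q \in unitmx := spectral_unit AC.
have DD_real : diag_mx D \is a mxOver Num.real.
  apply/mxOverP => i j; rewrite mxE; case: eqP => _; rewrite ?mulr0n ?real0 //.
  by rewrite mulr1n (mxOverP D_real).
have AC_sim : exists2 P : 'M_n, P \in unitmx & similar P AC (diag_mx D).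
  exists Q => //; apply/similarP => //.
  by rewrite [in LHS]AC_diag !mulmxA mulmxV // mul1mx.
have [P] := real_similar AC_sim AC_real DD_real.
rewrite inE => /andP[/= P_real P_unit] /(similarP P_unit) PA.
pose re := @complex.Re R.
have reK m1 m2 (M : 'M[complex R]_(m1, m2)) : M \is a mxOver Num.real ->
    map_mx f (map_mx re M) = M.
  move=> /mxOverP M_real; apply/matrixP => i j; rewrite !mxE.
  exact: RRe_real.
pose P' := map_mx re P; pose d := map_mx re D.
have PA' : P' *m A = diag_mx d *m P'.
  by apply: (map_mx_inj (f := f)); rewrite !map_mxM map_diag_mx !reK.
have P'_unit : P' \in unitmx by rewrite -(map_unitmx f) reK.
exists P', d; split => // i.
have v_eig : row i P' *m A = d 0 i *: row i P'.
  by rewrite -row_mul PA' row_mul row_diag_mx -scalemxAl -rowE.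
have v_neq0 : row i P' != 0.
  rewrite rowE -(mul0mx _ P') (can_eq (mulmxK P'_unit)).
  by apply/eqP => /matrixP/(_ 0 i)/eqP; rewrite !mxE !eqxx oner_eq0.
have := A_ge0 (row i P')^T; rewrite trmxK v_eig -scalemxAl mxE pmulr_lge0 //.
rewrite lt_neqAle eq_sym mxE sumr_ge0 ?andbT; last first.
  by move=> j _; rewrite [_^T _ _]mxE -expr2 sqr_ge0.
apply: contra v_neq0; rewrite psumr_eq0 => [/allP v0|j _]; last first.
  by rewrite [_^T _ _]mxE -expr2 sqr_ge0.
apply/eqP/rowP => j; have := v0 j (mem_index_enum j).
by rewrite [_^T _ _]mxE -expr2 sqrf_eq0 [RHS]mxE => /eqP.
Qed.

Section Eigenvalues.
Context {R : rcfType} {n : nat}.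

(** Once the characteristic polynomial splits, the multiplicity of x on either
    side is its multiplicity as a root. *)
Lemma eigenvalues_split {M : 'M[R]_n} {s : seq R} :
  char_poly M = \prod_(x <- s) ('X - x%:P) -> perm_eq (eigenvalues M) s.
Proof.
move=> Ms; apply/allP => x _ /=; apply/eqP.
have M0 : char_poly M != 0 by rewrite monic_neq0 ?char_poly_monic.
have root_uniq : uniq (rootsR (char_poly M)) by exact: uniq_roots.
have mem_root : (x \in rootsR (char_poly M)) = root (char_poly M) x.
  by have /(_ x) := roots_on_rootsR M0; rewrite in_itv.
rewrite -(mu_prod_XsubC x s) -Ms /eigenvalues count_flatten -map_comp.
rewrite sumnE big_map.
under eq_bigr do rewrite /= count_nseq /=.
have [xr|xr] := boolP (x \in rootsR (char_poly M)).
  rewrite (bigD1_seq x) //= eqxx mul1n big1 ?addn0 // => y /negbTE.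
  by move=> yx; rewrite yx mul0n.
rewrite big1_seq ?mupNroot -?mem_root // => y /= yr.
by case: eqP => [yx|_]; [rewrite -yx yr in xr|].
Qed.

(** The case a = X, b = -1 is the characteristic polynomial; the case a = 1,
    b = X generates the elementary symmetric functions of the eigenvalues. *)
Lemma det_pencil_similar_diag {P M : 'M[R]_n} {d : 'rV[R]_n} (a b : {poly R}) :
  P \in unitmx -> P *m M = diag_mx d *m P ->
  \det (a%:M + b *: map_mx polyC M) = \prod_(i < n) (a + b * (d 0 i)%:P).
Proof.
move=> P_unit PM.
have PX_unit : \det (map_mx polyC P) \in GRing.unit.
  by rewrite det_map_mx rmorph_unit // -unitmxE.
apply: (mulrI PX_unit); rewrite -det_mulmx mulmxDr -scalemxAr -map_mxM PM.
rewrite map_mxM scalar_mxC scalemxAl -mulmxDl det_mulmx mulrC; congr (_ * _).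
rewrite -diag_const_mx map_diag_mx -linearZ -raddfD det_diag.
by apply: eq_bigr => i _; rewrite !mxE.
Qed.

Lemma char_poly_similar_diag {P M : 'M[R]_n} {d : 'rV[R]_n} :
  P \in unitmx -> P *m M = diag_mx d *m P ->
  char_poly M = \prod_(i < n) ('X - (d 0 i)%:P).
Proof.
move=> P_unit PM; rewrite /char_poly /char_poly_mx -scaleN1r.
rewrite (det_pencil_similar_diag _ _ P_unit PM).
by apply: eq_bigr => i _; rewrite mulN1r.
Qed.

Lemma det_similar_diag {P M : 'M[R]_n} {d : 'rV[R]_n} :
  P \in unitmx -> P *m M = diag_mx d *m P -> \det M = \prod_(i < n) d 0 i.
Proof.
move=> P_unit PM; have := P_unit; rewrite unitmxE => /mulrI; apply.
by rewrite -det_mulmx PM det_mulmx det_diag mulrC.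
Qed.

Lemma sqr_similar_diag {P M : 'M[R]_n} {d : 'rV[R]_n} :
    P *m M = diag_mx d *m P ->
  P *m (M *m M) = diag_mx (\row_i (d 0 i ^+ 2)) *m P.
Proof.
move=> PM; have -> : \row_i (d 0 i ^+ 2) = \row_i (d 0 i * d 0 i) by [].
by rewrite -mulmx_diag mulmxA PM -!mulmxA PM.
Qed.

(** For symmetric A, the matrix A^T A is A^2, with eigenvalues d_i^2, and the
    square root of d_i^2 is d_i when d_i is nonnegative. *)
Lemma singular_values_diag {A P : 'M[R]_n} {d : 'rV[R]_n} :
    A^T = A -> P \in unitmx -> P *m A = diag_mx d *m P ->
    (forall i, 0 <= d 0 i) ->
  perm_eq (singular_values A) [seq d 0 i | i <- enum 'I_n].
Proof.
move=> A_sym P_unit PA d_ge0; rewrite /singular_values perm_sort A_sym.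
have /eigenvalues_split : char_poly (A *m A)
    = \prod_(x <- [seq d 0 i ^+ 2 | i <- enum 'I_n]) ('X - x%:P).
  rewrite (char_poly_similar_diag P_unit (sqr_similar_diag PA)).
  rewrite big_map big_enum.
  by apply: eq_bigr => i _; rewrite mxE.
move=> /(perm_map Num.sqrt) /perm_trans-> //; rewrite -map_comp.
rewrite (eq_map (g := fun i => d 0 i)) // => i /=.
by rewrite sqrtr_sqr ger0_norm.
Qed.

Lemma trace_similar_diag {A P : 'M[R]_n} {d : 'rV[R]_n} :
  P \in unitmx -> P *m A = diag_mx d *m P -> \tr A = \sum_i d 0 i.
Proof.
move=> P_unit PA; rewrite -mxtrace_diag -[diag_mx d](mulmxK P_unit) -PA.
by rewrite mxtrace_mulC mulmxA mulVmx // mul1mx.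
Qed.

(** A diagonal matrix is a sum of one matrix of rank at most 1 per nonzero
    diagonal entry. *)
Lemma rank_similar_diag {A P : 'M[R]_n} {d : 'rV[R]_n} :
  P \in unitmx -> P *m A = diag_mx d *m P ->
  (\rank A <= #|[set i | (d 0 i != 0)%R]|)%N.
Proof.
move=> P_unit PA.
have -> : \rank A = \rank (diag_mx d).
  rewrite -(eqmxMfull A (_ : row_full P)) ?row_full_unit // PA.
  by rewrite mxrankMfree ?row_free_unit.
have -> : diag_mx d = \sum_(i | d 0 i != 0) d 0 i *: delta_mx i i.
  rewrite diag_mx_sum_delta [RHS]big_mkcond; apply: eq_bigr => i _.
  by case: eqP => // ->; rewrite scale0r.
rewrite cardsE -sum1_card; elim/big_rec2: _ => [|i m M _ IH].
  by rewrite mxrank0.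
rewrite (leq_trans (mxrank_add _ _)) // leq_add //.
by rewrite (leq_trans (mxrank_scale _ _)) // mxrank_delta.
Qed.

End Eigenvalues.

(** * Elementary symmetric functions and power sums *)

(** The k-th elementary symmetric function of the entries of l, read off its
    generating polynomial, which makes invariance under permutation and the
    recursion on l immediate. *)
Definition esym {R : comNzRingType} (l : seq R) (k : nat) : R :=
  (\prod_(x <- l) (1 + x *: 'X))`_k.

Section ElementarySymmetric.
Context {R : realDomainType}.
Implicit Types (l : seq R) (k : nat).

Lemma esym_consS x l k : esym (x :: l) k.+1 = esym l k.+1 + x * esym l k.
Proof.
by rewrite /esym big_cons mulrDl mul1r -scalerAl coefD coefZ coefXM.
Qed.

Lemma esym_cons0 x l : esym (x :: l) 0 = esym l 0.
Proof.
by rewrite /esym big_cons mulrDl mul1r -scalerAl coefD coefZ coefXM mulr0 addr0.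
Qed.

Lemma esym_perm l1 l2 k : perm_eq l1 l2 -> esym l1 k = esym l2 k.
Proof. by move=> l12; rewrite /esym (perm_big _ l12). Qed.

Lemma esym_ge0 l k : {in l, forall x, 0 <= x} -> 0 <= esym l k.
Proof.
elim: l k => [|x l IHl] k l_ge0; first by rewrite /esym big_nil coef1 ler0n.
have {}IHl j : 0 <= esym l j.
  by apply: IHl => y yl; rewrite l_ge0 // inE yl orbT.
case: k => [|k]; first by rewrite esym_cons0.
by rewrite esym_consS addr_ge0 // mulr_ge0 // l_ge0 // mem_head.
Qed.

Lemma esym_oversize l k : (size l < k)%N -> esym l k = 0.
Proof.
elim: l k => [|x l IHl] [|k] //= lk; first by rewrite /esym big_nil coef1.
by rewrite esym_consS !IHl // ?mulr0 ?addr0 // ltnW.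
Qed.

(** Split each product of k + 1 entries into its last factor and the product of
    the k others: the last factor comes from [drop k l] since k entries precede
    it.  The order of l is arbitrary; the induction adds entries at the end
    because they are then the ones that [drop k l] gains. *)
Lemma esym_succ_le l k : {in l, forall x, 0 <= x} ->
  esym l k.+1 <= esym l k * \sum_(x <- drop k l) x.
Proof.
elim/last_ind: l => [|l y IHl] l_ge0.
  by rewrite /esym !big_nil mulr0 coef1.
have y_ge0 : 0 <= y by apply: l_ge0; rewrite mem_rcons mem_head.
have {}l_ge0 : {in l, forall x, 0 <= x}.
  by move=> x xl; apply: l_ge0; rewrite mem_rcons inE xl orbT.
have {}IHl := IHl l_ge0.
have rconsE j : esym (rcons l y) j = esym (y :: l) j.
  by apply: esym_perm; rewrite perm_rcons.
have [lk|kl] := ltnP (size l) k.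
  rewrite esym_oversize ?size_rcons ?ltnS // mulr_ge0 //; last first.
    by rewrite drop_oversize ?size_rcons // big_nil.
  by rewrite rconsE esym_ge0 // => x; rewrite inE => /predU1P[->//|/l_ge0].
have e_le : esym l k <= esym (rcons l y) k.
  rewrite rconsE; case: k {IHl kl} => [|k]; first by rewrite esym_cons0.
  by rewrite esym_consS lerDl mulr_ge0 ?esym_ge0.
rewrite rconsE esym_consS -cats1 drop_cat ltn_neqAle kl andbT.
have -> : \sum_(x <- if k != size l then drop k l ++ [:: y]
                     else drop (k - size l) [:: y]) x
          = \sum_(x <- drop k l) x + y.
  case: eqP => [->|_] /=; last by rewrite big_cat big_seq1.
  by rewrite subnn drop0 drop_size big_nil big_seq1 add0r.
rewrite cats1; apply: le_trans (ler_wpM2r _ e_le); last first.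
  rewrite addr_ge0 // big_seq sumr_ge0 // => x /mem_drop; exact: l_ge0.
by rewrite mulrDr [y * _]mulrC lerD2r.
Qed.

Lemma esym_gt0 l k : {in l, forall x, 0 <= x} ->
  (k <= count (fun x => (0 < x)%R) l)%N -> 0 < esym l k.
Proof.
elim: l k => [|x l IHl] k l_ge0 /=.
  by rewrite leqn0 => /eqP ->; rewrite /esym big_nil coef1 ltr01.
have x_ge0 : 0 <= x by rewrite l_ge0 ?mem_head.
have {}l_ge0 : {in l, forall x, 0 <= x}.
  by move=> y yl; rewrite l_ge0 // inE yl orbT.
case: k => [|k]; first by rewrite esym_cons0 IHl.
rewrite esym_consS; case: ltP => [x_gt0|_].
  by rewrite add1n ltnS => kl; rewrite ltr_wpDl ?esym_ge0 // mulr_gt0 // IHl.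
by rewrite add0n => kl; rewrite ltr_wpDr ?IHl // mulr_ge0 // esym_ge0.
Qed.

Lemma sum_sqr_le l : {in l, forall x, 0 <= x} ->
  \sum_(x <- l) x ^+ 2 <= (\sum_(x <- l) x) ^+ 2.
Proof.
elim: l => [|x l IHl] l_ge0; first by rewrite !big_nil expr0n.
have x_ge0 : 0 <= x by rewrite l_ge0 ?mem_head.
have {}l_ge0 : {in l, forall x, 0 <= x}.
  by move=> y yl; rewrite l_ge0 // inE yl orbT.
have s_ge0 : 0 <= \sum_(y <- l) y by rewrite big_seq sumr_ge0.
rewrite !big_cons sqrrD -addrA lerD2l (le_trans (IHl l_ge0)) // lerDr.
by rewrite mulrn_wge0 // mulr_ge0.
Qed.

(** Cauchy-Schwarz against the constant vector: the variance of l is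
    nonnegative. *)
Lemma sqr_sum_le l :
  (\sum_(x <- l) x) ^+ 2 <= (size l)%:R * \sum_(x <- l) x ^+ 2.
Proof.
have [/size0nil->|m_gt0] := posnP (size l).
  by rewrite !big_nil mulr0 expr0n.
set S := \sum_(x <- l) x; set Q := \sum_(x <- l) x ^+ 2; set m := (size l)%:R.
(* m * x - S is m times the deviation of x from the mean. *)
have : 0 <= \sum_(x <- l) (m * x - S) ^+ 2.
  by rewrite sumr_ge0 // => x _; exact: sqr_ge0.
under eq_bigr => x _.
  have -> : (m * x - S) ^+ 2
      = m ^+ 2 * x ^+ 2 + (- (2 * m * S) * x + S ^+ 2) by ring.
  over.
rewrite !big_split /= -!mulr_sumr -/S -/Q big_const_seq count_predT iter_addr_0.
rewrite -[_ *+ size l]mulr_natl -/m.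
have -> : m ^+ 2 * Q + (- (2 * m * S) * S + S * (m * S))
    = m * (m * Q - S ^+ 2) by ring.
by rewrite pmulr_rge0 ?ltr0n // subr_ge0.
Qed.

End ElementarySymmetric.

(** * Averaging over sets of indices *)

(** If every index of positive weight had t i > b, the terms w i * (t i - b)
    would be nonnegative with a nonpositive sum, so all the weights would
    vanish. *)
Lemma weighted_mean {R : realDomainType} {I : finType} (P : pred I)
    (w t : I -> R) (b : R) :
    (forall i, P i -> 0 <= w i) -> 0 < \sum_(i | P i) w i ->
    \sum_(i | P i) w i * t i <= b * \sum_(i | P i) w i ->
  exists i, [/\ P i, 0 < w i & t i <= b].
Proof.
move=> w_ge0 w_gt0 wt_le.
have [/existsP[i /and3P[]]|/existsPn none] :=
  boolP [exists i, [&& P i, 0 < w i & t i <= b]]; first by exists i.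
have tb i : P i -> w i > 0 -> b < t i.
  by move=> Pi wi; have := none i; rewrite Pi wi /= ltNge.
have wtb_ge0 i : P i -> 0 <= w i * (t i - b).
  move=> Pi; have := w_ge0 i Pi; rewrite le_eqVlt => /predU1P[<-|wi].
    by rewrite mul0r.
  by apply: mulr_ge0; rewrite ?subr_ge0; apply: ltW => //; apply: tb.
have wtb_sum : \sum_(i | P i) w i * (t i - b) = 0.
  apply/eqP; rewrite eq_le sumr_ge0 // andbT.
  under eq_bigr do rewrite mulrBr.
  by rewrite sumrB -mulr_suml subr_le0 [_ * b]mulrC.
move: w_gt0; rewrite big1 ?ltxx // => i Pi.
apply/eqP; apply: contraT => wi_neq0.
have wi : 0 < w i by rewrite lt0r wi_neq0 w_ge0.
have /eqP := psumr_eq0P wtb_ge0 wtb_sum Pi.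
by rewrite mulf_eq0 (negbTE wi_neq0) subr_eq0 gt_eqF ?tb.
Qed.

(** A set K with r + 1 elements arises as J + i once for each i in K. *)
Lemma sum_setU1 {V : nmodType} {I : finType} (F : {set I} -> V) r :
  \sum_(J : {set I} | #|J| == r) \sum_(i | i \notin J) F (i |: J)
    = (\sum_(K : {set I} | #|K| == r.+1) F K) *+ r.+1.
Proof.
have step i : \sum_(J : {set I} | (#|J| == r) && (i \notin J)) F (i |: J)
            = \sum_(K : {set I} | (#|K| == r.+1) && (i \in K)) F K.
  rewrite (reindex_onto (fun K => K :\ i) (fun J => i |: J))
    => [|J /andP[_ iJ]].
    apply: eq_big => [K|K /andP[_ /eqP ->] //]; rewrite !inE eqxx /= andbT.
    have [iK|iK] := boolP (i \in K); last first.
      rewrite andbF; apply/negP => /andP[_ /eqP KE].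
      by rewrite -KE !inE eqxx in iK.
    by rewrite setD1K // eqxx !andbT (cardsD1 i K) iK.
  by rewrite setU1K.
rewrite (exchange_big_dep predT) //=; under eq_bigr do rewrite step.
rewrite (exchange_big_dep (fun K : {set I} => #|K| == r.+1)) /=; last first.
  by move=> i K _ /andP[].
rewrite -sumrMnl; apply: eq_bigr => K /eqP Kr.
rewrite (eq_bigl (mem K)) => [|i]; last by rewrite Kr eqxx.
by rewrite sumr_const Kr.
Qed.
(** * Singular values and norms of positive semidefinite matrices *)

Section PsdSpectrum.
Context {R : rcfType} {n : nat} {A : 'M[R]_n}.
Hypothesis A_psd : psdmx A.
Local Notation sv := (singular_values A).

Lemma psd_singular_values : exists (P : 'M[R]_n) (d : 'rV[R]_n),
  [/\ P \in unitmx, P *m A = diag_mx d *m P, forall i, 0 <= d 0 i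
    & perm_eq sv [seq d 0 i | i <- enum 'I_n]].
Proof.
have [P [d [P_unit PA d_ge0]]] := psd_diagonalizable A_psd.
exists P, d; split=> //; case: A_psd => A_sym _.
exact: singular_values_diag A_sym P_unit PA d_ge0.
Qed.

Lemma size_psd_singular_values : size sv = n.
Proof.
have [P [d [_ _ _ /perm_size ->]]] := psd_singular_values.
by rewrite size_map size_enum_ord.
Qed.

Lemma psd_singular_values_ge0 : {in sv, forall x, 0 <= x}.
Proof.
have [P [d [_ _ d_ge0 /perm_mem dE]]] := psd_singular_values.
by move=> x; rewrite dE => /mapP[i _ ->].
Qed.

Lemma trace_psd : \tr A = \sum_(x <- sv) x.
Proof.
have [P [d [P_unit PA _ dE]]] := psd_singular_values.
by rewrite (trace_similar_diag P_unit PA) (perm_big _ dE) big_map big_enum.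
Qed.

Lemma sum_sqr_psd : \sum_i \sum_j A i j ^+ 2 = \sum_(x <- sv) x ^+ 2.
Proof.
have [P [d [P_unit PA _ dE]]] := psd_singular_values; case: A_psd => A_sym _.
rewrite (perm_big _ dE) big_map big_enum /=.
transitivity (\tr (A *m A)); last first.
  rewrite (trace_similar_diag P_unit (sqr_similar_diag PA)).
  by apply: eq_bigr => i _; rewrite mxE.
apply: eq_bigr => i _; rewrite mxE; apply: eq_bigr => j _.
by rewrite -[in A j i]A_sym [A^T _ _]mxE expr2.
Qed.

(** Both sides are the coefficient of X^k in det(1 + XA): the left one by
    diagonalizing A, the right one by expanding along sets of rows. *)
Lemma esym_singular_values k :
  esym sv k = \sum_(J : {set 'I_n} | #|J| == k) \det (submat A J J).
Proof.
have [P [d [P_unit PA _ dE]]] := psd_singular_values.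
have := det_pencil_similar_diag 1 'X P_unit PA; rewrite det_1_addX.
move=> /(congr1 (fun p : {poly R} => p`_k)); rewrite coef_sum => detE.
rewrite (esym_perm _ dE) /esym big_map big_enum /=.
transitivity ((\prod_(i < n) (1 + 'X * (d 0 i)%:P))`_k).
  congr (polyseq _)`_k; apply: eq_bigr => i _.
  by rewrite mulrC mul_polyC.
rewrite -detE [RHS]big_mkcond; apply: eq_bigr => J _.
by rewrite coefCM coefXn eq_sym; case: eqP; rewrite ?mulr1 ?mulr0.
Qed.

Lemma det_psd_ge0 : 0 <= \det A.
Proof.
have [P [d [P_unit PA d_ge0 _]]] := psd_singular_values.
by rewrite (det_similar_diag P_unit PA) prodr_ge0.
Qed.

Lemma rank_psd_le : (\rank A <= count (fun x => (0 < x)%R) sv)%N.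
Proof.
have [P [d [P_unit PA d_ge0 /permP ->]]] := psd_singular_values.
apply: leq_trans (rank_similar_diag P_unit PA) _.
rewrite cardsE cardE size_filter count_map enumT; apply: sub_count => i /=.
by rewrite lt0r d_ge0 andbT.
Qed.

End PsdSpectrum.

Section Norms.
Context {R : rcfType} {n : nat} {A : 'M[R]_n}.
Hypothesis A_psd : psdmx A.

Lemma sum_sigma_psd (F : R -> R) r :
  \sum_(r.+1 <= s < n.+1) F (sigma A s)
    = \sum_(x <- drop r (singular_values A)) F x.
Proof.
rewrite big_add1 /= [RHS](big_nth 0) size_drop (size_psd_singular_values A_psd).
rewrite -{1}[r]add0n big_addn; apply: eq_bigr => i _.
by rewrite nth_drop addnC.
Qed.

Lemma nuclear_norm_psd : nuclear_norm A = \tr A.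
Proof. by rewrite /nuclear_norm (sum_sigma_psd id) drop0 (trace_psd A_psd). Qed.

(** The 2-norm of the nonnegative vector of eigenvalues is at most its
    1-norm. *)
Lemma frobenius_norm_psd_le : frobenius_norm A <= \tr A.
Proof.
have sv_ge0 := psd_singular_values_ge0 A_psd.
have s_ge0 : 0 <= \sum_(x <- singular_values A) x by rewrite big_seq sumr_ge0.
rewrite /frobenius_norm (sum_sqr_psd A_psd) (trace_psd A_psd).
rewrite -[leRHS](ger0_norm s_ge0) -sqrtr_sqr ler_wsqrtr //.
exact: sum_sqr_le.
Qed.

End Norms.

(** * Choice of the index set *)

Lemma psdmx_congr (R : numDomainType) (m n : nat) (A : 'M[R]_m)
    (B : 'M[R]_(m, n)) :
  psdmx A -> psdmx (B^T *m A *m B).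
Proof.
move=> [A_sym A_ge0]; split=> [|x].
  by rewrite !trmx_mul trmxK A_sym mulmxA.
by have := A_ge0 (B *m x); rewrite trmx_mul !mulmxA.
Qed.

Lemma psdmx_submat (R : numDomainType) (n : nat) (A : 'M[R]_n) J :
  psdmx A -> psdmx (submat A J J).
Proof. by rewrite submat_sel => /psdmx_congr. Qed.

(** With V = [residual_map A J], the residual AV equals V^T A V: the rows of AV
    in J vanish, so V^T acts on it as the identity. *)
Lemma psdmx_cross_residual (R : numFieldType) (n : nat) (A : 'M[R]_n) J :
  submat A J J \in unitmx -> psdmx A -> psdmx (A - cross_approx A J).
Proof.
move=> AJ_unit A_psd; have [A_sym _] := A_psd.
have [AJ_sym _] := psdmx_submat J A_psd.
suff -> : A - cross_approx A J
    = (residual_map A J)^T *m A *m residual_map A J.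
  exact: psdmx_congr.
rewrite -mulmxA -residualE /residual_map [(_ - _)^T]raddfB /= trmx1.
rewrite mulmxBl mul1mx.
rewrite !trmx_mul trmx_inv AJ_sym -!mulmxA tr_sel_residual //.
by rewrite !mulmx0 subr0.
Qed.

Lemma trace_cross_residual (R : fieldType) (n : nat) (A : 'M[R]_n) J :
  submat A J J \in unitmx ->
  \det (submat A J J) * \tr (A - cross_approx A J)
    = \sum_(i | i \notin J) \det (submat A (i |: J) (i |: J)).
Proof.
move=> AJ_unit; rewrite mulr_sumr (bigID (mem J)) /= big1 ?add0r => [|i iJ].
  by apply: eq_bigr => i iJ; rewrite (det_submat_setU1 AJ_unit iJ).
by rewrite residual_row0 // mulr0.
Qed.

(** The volume sampling argument: [w J] is the weight of J and b bounds the
    mean of the traces [t J]. *)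
Lemma exists_psd_cross_approx (R : rcfType) (n r : nat) (A : 'M[R]_n) :
  psdmx A -> (r <= \rank A)%N ->
  exists J : {set 'I_n}, [/\ #|J| = r, submat A J J \in unitmx
    & \tr (A - cross_approx A J)
        <= (r + 1)%:R * \sum_(x <- drop r (singular_values A)) x].
Proof.
move=> A_psd rk; have sv_ge0 := psd_singular_values_ge0 A_psd.
have minor_ge0 J : 0 <= \det (submat A J J).
  exact: det_psd_ge0 (psdmx_submat J A_psd).
pose w J := \det (submat A J J); pose t J := \tr (A - cross_approx A J).
set b := _%:R * _.
have [|||J [/eqP Jr wJ tJ]] :=
  @weighted_mean R _ (fun J : {set 'I_n} => #|J| == r) w t b.
- by move=> J _; exact: minor_ge0.
- rewrite -esym_singular_values // esym_gt0 //.
  exact: leq_trans rk (rank_psd_le A_psd).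
- apply: le_trans (_ : \sum_(J : {set 'I_n} | #|J| == r)
                         \sum_(i | i \notin J) w (i |: J) <= _).
    (* Sets J of weight 0 contribute nothing to the mean, so for them it is
       enough that the minors on the right are nonnegative. *)
    apply: ler_sum => J _; have [w0|w_neq0] := eqVneq (w J) 0.
      by rewrite w0 mul0r sumr_ge0 // => i _; exact: minor_ge0.
    by rewrite trace_cross_residual // unitmxE unitfE.
  rewrite sum_setU1 -!esym_singular_values // -[_ *+ _]mulr_natl /b addn1.
  by rewrite -mulrA ler_wpM2l // mulrC esym_succ_le.
exists J; split=> //; by rewrite unitmxE unitfE gt_eqF.
Qed.

Theorem theorem3p1 (R : realType) (n k r : nat) (A : 'M[R]_n)
    (hA : psdmx A) (hk : \rank A = k) (hr : (1 <= r <= k)%N) :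
  exists J : {set 'I_n},
    [/\ #|J| = r,
        submat A J J \in unitmx,
        nuclear_norm (A - cross_approx A J)
          <= (r + 1)%:R * \sum_(r.+1 <= s < n.+1) sigma A s
      & frobenius_norm (A - cross_approx A J)
          <= Num.sqrt (n - r)%:R * (r + 1)%:R
             * Num.sqrt (\sum_(r.+1 <= s < n.+1) sigma A s ^+ 2)].
Proof.
have rk : (r <= \rank A)%N by rewrite hk; case/andP: hr.
have [J [Jr AJ_unit tr_le]] := exists_psd_cross_approx hA rk.
have res_psd := psdmx_cross_residual AJ_unit hA.
exists J; split=> //.
  by rewrite (nuclear_norm_psd res_psd) (sum_sigma_psd hA id).
apply: le_trans (frobenius_norm_psd_le res_psd) _; apply: le_trans tr_le _.
rewrite (sum_sigma_psd hA (fun x => x ^+ 2)) [_ * (r + 1)%:R]mulrC -mulrA.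
rewrite ler_wpM2l // -sqrtrM //.
have -> : (n - r)%N = size (drop r (singular_values A)).
  by rewrite size_drop size_psd_singular_values.
(* What remains is Cauchy-Schwarz on the n - r last singular values. *)
apply: le_trans (ler_norm _) _; rewrite -sqrtr_sqr ler_wsqrtr //.
exact: sqr_sum_le.
Qed.
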